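(* Let $X$ and $Y$ be proper discrete metric spaces, let $n\in\mathbb{N}$, and let $f\colon X\to Y$ be coarse. Let $\nu f\colon \nu X\to\nu Y$ be the induced map of Higson coronas. Then the following are equivalent: (1) $f$ is coarsely $n$-to-$1$; (2) $\nu f$ is $n$-to-$1$, i.e. $|(\nu f)^{-1}(y)|\le n$ for each $y\in\nu Y$; (3) if $\{A_1,A_2,\ldots,A_k\}$ is a gradually disjoint collection of subsets of $X$ for which the collection $\{f(A_1),f(A_2),\ldots,f(A_k)\}$ does not diverge, then $k\le n$.
   Context: $\mathbb{N}=\{1,2,\ldots\}$. A metric space is proper if the closure of each bounded set is compact; discrete means topologically discrete. A map of metric spaces is proper if preimages of bounded sets are bounded. A map $f\colon X\to Y$ is coarse if it is proper and for each $R>0$ there exists $S>0$ such that $d(x,y)\le R$ implies $d(f(x),f(y))\le S$. It is coarsely $n$-to-$1$ if for each $R>0$ there exists $S>0$ such that for each $A\subset Y$ of diameter at most $R$, the preimage $f^{-1}(A)$ can be covered by at most $n$ subsets of $X$ of diameter at most $S$. Write $N(A,R)=\{y\in X: d(y,A)\le R\}$ and $N(x,R)=N(\{x\},R)$. A function $\varphi\colon X\to\mathbb{C}$ is slowly oscillating if for all $R,\epsilon>0$ there is a bounded $B\subset X$ with $\mathrm{diam}(\varphi(N(x,R)\setminus B))\le\epsilon$ for all $x\in X$. $C_h(X)$ is the set of bounded continuous slowly oscillating functions $X\to\mathbb{C}$. The Higson compactification $hX$ is the closure of the image of $X$ under the embedding $x\mapsto(\varphi(x))_{\varphi\in C_h(X)}$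 in $\prod_{\varphi\in C_h(X)}\overline{\varphi(X)}$, and the Higson corona is $\nu X=hX\setminus X$. A coarse map $f$ between proper discrete metric spaces extends uniquely to a continuous map $hf\colon hX\to hY$ with $hf(\nu X)\subset\nu Y$, and $\nu f=hf|_{\nu X}\colon\nu X\to\nu Y$. Collections are indexed by $1,\ldots,k$. A collection $\{A_1,\ldots,A_k\}$ of disjoint subsets of a metric space is gradually disjoint if for each $R>0$ there is a bounded set $B$ such that the sets $N(A_i,R)\setminus B$ are pairwise disjoint. A collection $\{A_1,\ldots,A_k\}$ of (not necessarily disjoint) subsets of a metric space diverges if for each $R>0$ the intersection $\bigcap_{i=1}^kN(A_i,R)$ is bounded. *)

(* Defs.v *)
From HB Require Import structures.
From mathcomp Require Import all_boot all_order all_algebra.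
From mathcomp Require Import all_classical all_reals all_analysis.
From mathcomp Require Import complex.

Set Implicit Arguments.
Unset Strict Implicit.
Unset Printing Implicit Defensive.

Import Order.TTheory GRing.Theory Num.Theory.

Local Open Scope classical_set_scope.
Local Open Scope card_scope.
Local Open Scope ring_scope.

(* The complex numbers R[i] as a metric space over R, with distance |z - w|
   (ComplexField.Normc.normc is the modulus with values in R rather than in R[i]).
   The topology is the one the library puts on R[i]^o; see nbhs_complexE. *)
Section ComplexMetric.
Variable R : realType.

Definition complex_dist (z w : R[i]) : R := ComplexField.Normc.normc (z - w).

Fact complex_distxx z : complex_dist z z = 0.
Proof. by rewrite /complex_dist subrr ComplexField.Normc.normc0. Qed.

Fact complex_dist_positivity z w : complex_dist z w = 0 -> z = w.
Proof.
by move=> /ComplexField.Normc.eq0_normc/eqP; rewrite subr_eq0 => /eqP.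
Qed.

Fact complex_dist_sym z w : complex_dist z w = complex_dist w z.
Proof. by rewrite /complex_dist -normcN opprB. Qed.

Fact complex_dist_triangle y x z :
  complex_dist x z <= complex_dist x y + complex_dist y z.
Proof.
have -> : complex_dist x z = ComplexField.Normc.normc ((x - y) + (y - z)).
  by rewrite addrA subrK.
exact: le_normcD.
Qed.

HB.instance Definition _ := @isMetric.Build R R[i] complex_dist complex_distxx
  complex_dist_positivity complex_dist_sym complex_dist_triangle.

Lemma nbhs_complexE (z : R[i]) : nbhs z = @nbhs R[i] R[i]^o z.
Proof.
have bE (e : R) : ball z e = [set w : R[i] | `|z - w| < e%:C%C].
  apply/seteqP; split => w; rewrite ballEmdist /= /mdist /= /complex_dist;
  by rewrite normc_def ltcR; case: (z - w).
apply/seteqP; split => A.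
  rewrite -nbhs_ballE => -[e /= e0 eA]; exists e%:C%C; first by rewrite /= ltcR.
  by move=> w wz; apply: eA; rewrite bE.
move=> [e /= e0 eA]; rewrite -nbhs_ballE.
have e1 : (complex.Re e)%:C%C = e.
  by apply/eqP; rewrite RRe_real // gtr0_real.
exists (complex.Re e); first by rewrite /= -ltcR e1.
by move=> w; rewrite bE /= e1 => /eA.
Qed.

End ComplexMetric.

Section Metric.
Variables (R : realType) (X : metricType R).
Implicit Types (A B : set X) (r : R).

(* Adjoining 0 makes the diameter of the empty set 0. *)
Definition diam A : \bar R :=
  ereal_sup (0%E |` [set (mdist p.1 p.2)%:E | p in A `*` A]).

Definition metric_bounded A :=
  exists r, forall x y, A x -> A y -> mdist x y <= r.

Definition proper_space := forall A, metric_bounded A -> compact (closure A).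

Definition topologically_discrete := forall x : X, open [set x].

(* This is +oo when A is empty. *)
Definition dist_to (x : X) A : \bar R := ereal_inf [set (mdist x a)%:E | a in A].

Definition thickening A r : set X := [set x | (dist_to x A <= r%:E)%E].

Definition gradually_disjoint (k : nat) (A : 'I_k -> set X) :=
  trivIset setT A /\
  forall r, 0 < r -> exists2 B, metric_bounded B &
    trivIset setT (fun i => thickening (A i) r `\` B).

Definition diverges (k : nat) (A : 'I_k -> set X) :=
  forall r, 0 < r -> metric_bounded (\bigcap_i thickening (A i) r).

Lemma diam_leP A r : 0 <= r ->
  (diam A <= r%:E)%E <-> forall x y, A x -> A y -> mdist x y <= r.
Proof.
move=> r0; split=> [Ar x y Ax Ay|Ar].
  rewrite -lee_fin; apply: le_trans Ar; apply: ereal_sup_ubound.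
  by right; exists (x, y).
apply: ge_ereal_sup => _ [->|[[x y] [/= Ax Ay] <-]].
  by rewrite lee_fin.
by rewrite lee_fin; exact: Ar.
Qed.

End Metric.
Arguments proper_space {R} X.
Arguments topologically_discrete {R} X.

Section Maps.
Variables (R : realType) (X Y : metricType R).
Implicit Type f : X -> Y.

Definition proper_map f :=
  forall B, metric_bounded B -> metric_bounded (f @^-1` B).

Definition coarse f := proper_map f /\
  forall r : R, 0 < r -> exists2 s : R, 0 < s &
    forall x y, mdist x y <= r -> mdist (f x) (f y) <= s.

Definition coarsely_n_to_1 (n : nat) f :=
  forall r : R, 0 < r -> exists2 s : R, 0 < s &
    forall A : set Y, (diam A <= r%:E)%E ->
      exists2 m : nat, (m <= n)%N &
        exists2 U : 'I_m -> set X,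
          (forall i, (diam (U i) <= s%:E)%E) & f @^-1` A `<=` \bigcup_i U i.

End Maps.

Definition n_to_1 (n : nat) (S T : Type) (g : S -> T) :=
  forall y, g @^-1` [set y] #<= `I_n.

Section Higson.
Variables (R : realType) (X : metricType R).

Definition slowly_oscillating (phi : X -> R[i]) :=
  forall r e : R, 0 < r -> 0 < e -> exists2 B : set X, metric_bounded B &
    forall x, (diam (phi @` (thickening [set x] r `\` B)) <= e%:E)%E.

Definition higson_functions : set (X -> R[i]) :=
  [set phi | [/\ metric_bounded (range phi), continuous phi &
                 slowly_oscillating phi]].

Definition higson_factor (phi : higson_functions) : topologicalType :=
  closure (range (val phi)).

Definition higson_product : topologicalType := prod_topology higson_factor.

Definition higson_eval (x : X) : higson_product := fun phi =>
  exist _ (val phi x) (mem_set (subset_closure (imageT (val phi) x))).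

Definition higson : topologicalType := closure (range higson_eval).

Definition higson_embed (x : X) : higson :=
  exist _ (higson_eval x) (mem_set (subset_closure (imageT higson_eval x))).

Definition corona : topologicalType := ~` range higson_embed.

End Higson.
Arguments higson_functions {R} X.

Section HigsonTheory.
Variables (R : realType) (X : metricType R).

Lemma hausdorff_set_type (T : topologicalType) (A : set T) :
  hausdorff_space T -> hausdorff_space (set_type A).
Proof.
move=> hT x y xy; apply/val_inj/hT => U V Ux Vy.
have [z [Uz Vz]] := xy (val @^-1` U) (val @^-1` V)
  (initial_continuous Ux) (initial_continuous Vy).
by exists (val z).
Qed.

Lemma higson_product_hausdorff : hausdorff_space (higson_product X).
Proof.
apply: (@hausdorff_product _ (@higson_factor R X)) => phi.
by apply: hausdorff_set_type; exact: metric_hausdorff.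
Qed.

Lemma higson_hausdorff : hausdorff_space (higson X).
Proof. exact/hausdorff_set_type/higson_product_hausdorff. Qed.

Lemma continuous_val (T : topologicalType) (A : set T) :
  continuous (val : set_type A -> T).
Proof. exact: initial_continuous. Qed.

Lemma higson_proj_continuous (phi : higson_functions X) :
  continuous (fun q : higson_product X => q phi).
Proof. exact: (@proj_continuous _ (@higson_factor R X)). Qed.

Lemma higson_coord_continuous (phi : higson_functions X) :
  continuous (fun p : higson X => val (val p phi) : R[i]).
Proof.
move=> p.
have c1 := continuous_comp (@continuous_val _ _ p) (@higson_proj_continuous phi _).
exact: (continuous_comp c1 (@continuous_val _ _ _)).
Qed.

Lemma higson_eqP (p q : higson X) :
  (forall phi : higson_functions X, val (val p phi) = val (val q phi)) -> p = q.
Proof.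
by move=> pq; apply/val_inj/functional_extensionality_dep => phi; exact/val_inj.
Qed.

Lemma continuous_to_product (T : topologicalType) (g : T -> higson_product X) :
  (forall phi : higson_functions X, continuous (fun t => val (g t phi) : R[i])) ->
  continuous g.
Proof.
move=> cg t; apply/cvg_sup => phi; move: t.
apply: (@continuous_comp_initial _ _ _ (fun q : higson_product X => q phi)).
exact/continuous_comp_initial/cg.
Qed.

Lemma continuous_to_higson (T : topologicalType) (g : T -> higson X) :
  (forall phi : higson_functions X,
     continuous (fun t => val (val (g t) phi) : R[i])) -> continuous g.
Proof. by move=> cg; exact/continuous_comp_initial/continuous_to_product. Qed.

Lemma higson_embed_dense (p : higson X) : closure (range (@higson_embed R X)) p.
Proof.
move=> U; rewrite nbhsE => -[_ [[W oW <-] Wp] WU].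
have /set_mem /(_ W) [] := valP p; first exact: open_nbhs_nbhs.
by move=> _ [[x _ <-] Wx]; exists (higson_embed x); split; [exists x|exact: WU].
Qed.

End HigsonTheory.

Section HigsonMap.
Variables (R : realType) (X Y : metricType R).
Hypothesis dX : topologically_discrete X.

Lemma higson_map_unique (f : X -> Y) (g h : higson X -> higson Y) :
  continuous g -> continuous h ->
  (forall x, g (higson_embed x) = higson_embed (f x)) ->
  (forall x, h (higson_embed x) = higson_embed (f x)) -> g = h.
Proof.
move=> cg ch gf hf; apply/funext => p; apply: (@higson_hausdorff R Y) => U V Ug Vh.
have /higson_embed_dense [_ [[x _ <-] [Ux Vx]]] : nbhs p (g @^-1` U `&` h @^-1` V).
  by apply: filterI; [exact: cg|exact: ch].
by exists (higson_embed (f x)); split; [rewrite -gf|rewrite -hf].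
Qed.

Lemma discrete_continuous (T : topologicalType) (g : X -> T) : continuous g.
Proof.
move=> x U Ug; apply: (@filterS _ _ _ [set x]).
  by move=> y ->; exact: (nbhs_singleton Ug).
by apply: open_nbhs_nbhs; split; first exact: dX.
Qed.

Lemma coarse_thickening (f : X -> Y) r s x :
  (forall x y, mdist x y <= r -> mdist (f x) (f y) <= s) ->
  f @` thickening [set x] r `<=` thickening [set f x] s.
Proof.
move=> fs _ [y xy <-]; move: xy.
by rewrite /thickening /dist_to /= !image_set1 !ereal_inf1 !lee_fin; exact: fs.
Qed.

Lemma higson_functions_comp (f : X -> Y) (phi : higson_functions Y) :
  coarse f -> (val phi \o f) \in higson_functions X.
Proof.
move=> [pf cf]; apply/mem_set.
have /set_mem [[M phiM] _ sphi] := valP phi; split.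
- exists M => _ _ [x _ <-] [y _ <-]; exact: phiM.
- exact: discrete_continuous.
- move=> r e r0 e0; have [s s0 fs] := cf r r0.
  have [B bB phiB] := sphi s e s0 e0.
  exists (f @^-1` B); first exact: pf.
  move=> x; apply: le_trans (phiB (f x)); apply: ereal_sup_le.
  apply: setUS => _ [[_ _] [[y [xy By] <-] [z [xz Bz] <-]] <-].
  exists (val phi (f y), val phi (f z)) => //.
  split => /=.
    exists (f y) => //; split => //.
    by apply: (coarse_thickening fs); exists y.
  exists (f z) => //; split => //.
  by apply: (coarse_thickening fs); exists z.
Qed.

Lemma higson_map_exists (f : X -> Y) : coarse f ->
  exists! g : higson X -> higson Y,
    continuous g /\ forall x, g (higson_embed x) = higson_embed (f x).
Proof.
move=> cf.
pose comp phi : higson_functions X :=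
  exist (fun h => h \in higson_functions X) _ (higson_functions_comp phi cf).
have G_subproof (p : higson_product X) phi :
    val (p (comp phi)) \in closure (range (val phi)).
  apply/mem_set; have /set_mem := valP (p (comp phi)).
  by apply: closureS => _ [x _ <-]; exists (f x).
pose G p : higson_product Y := fun phi =>
  exist (fun z => z \in closure (range (val phi))) _ (G_subproof p phi).
have cG : continuous G.
  apply: continuous_to_product => phi p.
  exact: (continuous_comp (@higson_proj_continuous _ _ (comp phi) p)
    (@continuous_val _ _ _)).
have Gf x : G (higson_eval x) = higson_eval (f x).
  by apply: functional_extensionality_dep => phi; exact: val_inj.
have g_subproof (p : higson X) : G (val p) \in closure (range (@higson_eval R Y)).
  apply/mem_set => U /cG; have /set_mem pX := valP p.
  by move/pX => [_ [[x _ <-]]]; rewrite /= Gf; exists (higson_eval (f x)).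
exists (fun p => exist (fun q => q \in closure (range (@higson_eval R Y))) _
                       (g_subproof p)); split.
  split=> [|x]; last by apply: val_inj; exact: Gf.
  apply: continuous_comp_initial => p.
  exact: (continuous_comp (@continuous_val _ _ p) (cG _)).
move=> h [ch hf]; apply: (@higson_map_unique f) => //.
  apply: continuous_comp_initial => p.
  exact: (continuous_comp (@continuous_val _ _ p) (cG _)).
by move=> x; apply: val_inj; exact: Gf.
Qed.

Lemma bounded_finite (A : set X) :
  proper_space X -> metric_bounded A -> finite_set A.
Proof.
move=> pX /pX; have -> : closure A = A.
  apply/esym/closure_id; rewrite -openC openE => x Ax.
  apply: (@filterS _ _ _ [set x]); first by move=> y ->.
  by apply: open_nbhs_nbhs; split; first exact: dX.
move=> cA; apply: contrapT => infA.
pose F : set_system X := [set U | finite_set (A `\` U)].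
have FF : ProperFilter F.
  split; first by rewrite /F /= setD0.
  split=> [|U V|U V UV] /=.
  - by rewrite /F /= setDT; exact: finite_set0.
  - by rewrite /F /= setDIr finite_setU.
  - by apply: sub_finite_set; exact: setDS.
have FA : F A by rewrite /F /= setDv; exact: finite_set0.
have [x [Ax Fx]] := cA F FF FA.
have [] := Fx (~` [set x]) [set x].
- by rewrite /F /= setDE setCK; apply: finite_setIr; exact: finite_set1.
- by apply: open_nbhs_nbhs; split; first exact: dX.
- by move=> y [].
Qed.

Definition dirac_fun (y : X) : X -> R[i] := fun x => (x == y)%:R.

Lemma dirac_fun_higson y : dirac_fun y \in higson_functions X.
Proof.
apply/mem_set; split.
- exists 1 => _ _ [x _ <-] [z _ <-].
  rewrite /mdist /= /complex_dist /dirac_fun.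
  by case: (x == y); case: (z == y);
    rewrite ?subrr ?subr0 ?sub0r ?normcN ?ComplexField.Normc.normc0
            ?ComplexField.Normc.normc1.
- exact: discrete_continuous.
- move=> r e _ e0; exists [set y].
    by exists 0 => _ _ -> ->; rewrite mdistxx.
  move=> x; apply/diam_leP; first exact: ltW.
  move=> _ _ [s [_ /eqP/negbTE sy] <-] [t [_ /eqP/negbTE ty] <-].
  by rewrite /dirac_fun sy ty mdistxx ltW.
Qed.

End HigsonMap.

Section HigsonCorona.
Variables (R : realType) (X Y : metricType R).
Hypotheses (pX : proper_space X) (dX : topologically_discrete X).
Hypothesis dY : topologically_discrete Y.

Lemma higson_map_corona (f : X -> Y) (h : higson X -> higson Y) :
  coarse f -> continuous h ->
  (forall x, h (higson_embed x) = higson_embed (f x)) ->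
  forall p, (~` range (@higson_embed R X)) p ->
    (~` range (@higson_embed R Y)) (h p).
Proof.
move=> [pf _] ch hf p pE [y _ yhp]; apply: pE.
pose phi : higson_functions Y :=
  exist (fun h => h \in higson_functions Y) _ (dirac_fun_higson dY y).
pose c (q : higson X) : R[i] := val (val (h q) phi).
have cc : continuous c.
  move=> q; exact: (continuous_comp (ch q) (@higson_coord_continuous _ _ phi _)).
pose F := @higson_embed R X @` (f @^-1` [set y]).
have finF : finite_set F.
  apply: finite_image; apply: bounded_finite => //; apply: pf.
  by exists 0 => _ _ -> ->; rewrite mdistxx.
have clF : closed F.
  have /accessible_finite_set_closed : accessible_space (higson X).
    exact/hausdorff_accessible/higson_hausdorff.
  exact.
suff /clF [x _ <-] : closure F p by exists x.
move=> U Up.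
have /higson_embed_dense [_ [[x _ <-] [Ux cx]]] :
    nbhs p (U `&` c @^-1` (ball (c p) 1)).
  apply: filterI => //; apply: cc; exact: nbhsx_ballx.
exists (higson_embed x); split=> //; exists x => //=.
move: cx; rewrite ballEmdist /= /c hf -yhp /= /dirac_fun eqxx.
case: eqP => // _.
by rewrite /mdist /= /complex_dist subr0 ComplexField.Normc.normc1 ltxx.
Qed.

(* The unique continuous extension of f; uniqueness is part of
   higson_map_exists. *)
Definition higson_map (f : X -> Y) (cf : coarse f) : higson X -> higson Y :=
  sval (cid (higson_map_exists dX cf)).

Lemma higson_map_continuous (f : X -> Y) (cf : coarse f) :
  continuous (higson_map cf).
Proof. by rewrite /higson_map; case: cid => h [[]]. Qed.

Lemma higson_map_embed (f : X -> Y) (cf : coarse f) (x : X) :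
  higson_map cf (higson_embed x) = higson_embed (f x).
Proof. by rewrite /higson_map; case: cid => h [[]]. Qed.

Definition corona_map (f : X -> Y) (cf : coarse f) (p : corona X) : corona Y :=
  exist _ (higson_map cf (val p))
    (mem_set (higson_map_corona cf (@higson_map_continuous f cf)
                (@higson_map_embed f cf) (set_mem (valP p)))).

End HigsonCorona.

(* Main.v *)
Require Import Defs.
From mathcomp Require Import all_boot all_order all_algebra.
From mathcomp Require Import all_classical all_reals all_analysis.
From mathcomp Require Import complex ring lra.

(** Condition (3) is the coarse shadow of both of the others, and it is reached
    from each of them.

    (1) implies (3): if the sets [f @` A i] do not diverge, some radius [r]
    admits points [y] arbitrarily far out that lie within [r] of every
    [f @` A i], so the preimage of one ball around [y] meets every [A i].  That
    preimage is covered by [n] sets of size [s], so [k > n] would put points of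
    two different [A i] within [s] of each other, which gradual disjointness
    forbids far out.

    (3) implies (1): if [f] is not coarsely [n]-to-[1], for each [m] there are
    [n + 1] points at pairwise distance more than [m] whose images lie within a
    fixed [r] of each other.  Since [f] is proper these tuples leave every
    bounded set, and after passing to a sparse subsequence the [n + 1] sets of
    coordinates are gradually disjoint, with images that do not diverge.

    The corona enters through two facts.  Distinct points of [higson X] have
    neighbourhoods whose traces on [X] diverge from each other
    ([higson_separation]): a Higson function separating the two points takes
    well-separated values on the traces, and it oscillates little far out.
    Conversely, the closures of a diverging family have no common corona point
    ([corona_closures_not_diverge]): the weights [d(x, C i) / (1 + s x)], where
    [s x] is the sum of all the distances [d(x, C j)], are slowly oscillating
    because [s] tends to infinity; each vanishes on its own [C i], and their sum
    tends to 1.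

    (3) implies (2): [n + 1] corona points over one [y] have neighbourhoods with
    gradually disjoint traces [A i], and [y] lies in the closure of every
    [f @` A i], so these images do not diverge.

    (2) implies (3): if the [f @` A i] all come within [r] of the points of an
    unbounded set [D], choose [a i y] in [A i] with [f (a i y)] near [y], and
    take limits along an ultrafilter on [D] that avoids bounded sets.  The limits
    of the [a i] are distinct since the [A i] diverge pairwise, and they all map
    to the limit of the [y] themselves. *)

Set Implicit Arguments.
Unset Strict Implicit.
Unset Printing Implicit Defensive.

Import Order.TTheory GRing.Theory Num.Theory.
Import numFieldNormedType.Exports.

Local Open Scope classical_set_scope.
Local Open Scope card_scope.
Local Open Scope ring_scope.

(** * Bounded sets, thickenings and divergence *)

Section BoundedSets.
Variables (R : realType) (X : metricType R).
Implicit Types (A B P Q : set X) (r : R) (x y : X).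

Lemma mem_thickening A r x a : A a -> mdist x a <= r -> thickening A r x.
Proof.
by move=> Aa xa; apply: ge_ereal_inf; exists (mdist x a)%:E => //; exists a.
Qed.

(** The distance to a set is an infimum that need not be attained, hence the
    slack of 1. *)
Lemma thickening_near A r x :
  thickening A r x -> exists2 a, A a & mdist x a <= r + 1.
Proof.
move=> xA; have : (dist_to x A < (r + 1)%:E)%E.
  by apply: le_lt_trans xA _; rewrite lte_fin ltrDl.
by move=> /ereal_inf_lt[_ [a Aa <-]]; rewrite lte_fin => /ltW xa; exists a.
Qed.

Lemma thickeningS A B r : A `<=` B -> thickening A r `<=` thickening B r.
Proof.
by move=> AB x; apply: le_trans; apply: ereal_inf_le_tmp; exact: image_subset.
Qed.

Lemma metric_boundedS A B : A `<=` B -> metric_bounded B -> metric_bounded A.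
Proof. by move=> AB [r Br]; exists r => x y /AB Bx /AB; exact: Br. Qed.

Lemma metric_bounded0 : metric_bounded (@set0 X).
Proof. by exists 0. Qed.

Lemma metric_bounded1 x : metric_bounded [set x].
Proof. by exists 0 => _ _ -> ->; rewrite mdistxx. Qed.

Lemma metric_bounded_from x A :
  metric_bounded A <-> exists r, forall a, A a -> mdist x a <= r.
Proof.
split=> [[r Ar]|[r Ar]]; last first.
  exists (r + r) => a b /Ar xa /Ar xb.
  by have := metric_triangle a x b; rewrite (metric_sym a x); lra.
have [->|/set0P[a Aa]] := eqVneq A set0; first by exists 0.
exists (mdist x a + r) => b /(Ar a b Aa) ab.
by have := metric_triangle x a b; lra.
Qed.

Lemma metric_bounded_ball x r : metric_bounded [set y | mdist x y <= r].
Proof. by apply/(metric_bounded_from x); exists r. Qed.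

Lemma metric_bounded_bigcup (I : finType) (B : I -> set X) :
  (forall i, metric_bounded (B i)) -> metric_bounded (\bigcup_i B i).
Proof.
move=> bB; have [->|/set0P[x _]] := eqVneq (\bigcup_i B i) set0.
  exact: metric_bounded0.
have /choice[r Br] i := (metric_bounded_from x (B i)).1 (bB i).
apply/(metric_bounded_from x); exists (\big[Num.max/0]_i r i) => a [i _ Bia].
exact: le_trans (Br i a Bia) (le_bigmax _ _ _).
Qed.

Lemma metric_boundedU A B :
  metric_bounded A -> metric_bounded B -> metric_bounded (A `|` B).
Proof.
move=> bA bB; apply: (@metric_boundedS _ (\bigcup_b if b then A else B)).
  by move=> x [Ax|Bx]; [exists true|exists false].
by apply: metric_bounded_bigcup => -[].
Qed.

Lemma metric_bounded_thickening A r :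
  metric_bounded A -> metric_bounded (thickening A r).
Proof.
move=> [s As]; exists (r + 1 + s + (r + 1)) => x y.
move=> /thickening_near[a Aa xa] /thickening_near[b Ab yb].
have := As a b Aa Ab; have := metric_triangle x a y.
by have := metric_triangle a b y; rewrite (metric_sym b y); lra.
Qed.

Lemma diam_ball x r : 0 <= r -> (diam [set y | (mdist x y <= r)%R] <= (r + r)%:E)%E.
Proof.
move=> r0; apply/diam_leP; first by lra.
move=> a b /= xa xb.
by have := metric_triangle a x b; rewrite (metric_sym a x); lra.
Qed.

(** The case of two sets, and the form in which gradual disjointness is used:
    it amounts to disjointness together with pairwise divergence. *)
Definition pair_diverges P Q :=
  forall r, 0 < r -> metric_bounded (thickening P r `&` thickening Q r).

Lemma pair_divergesS P P' Q Q' : P' `<=` P -> Q' `<=` Q ->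
  pair_diverges P Q -> pair_diverges P' Q'.
Proof.
move=> PP QQ dPQ r r0; apply: metric_boundedS (dPQ r r0).
by apply: setISS; exact: thickeningS.
Qed.

Lemma pair_divergesP P Q : pair_diverges P Q <->
  diverges (fun i : 'I_2 => if i == ord0 then P else Q).
Proof.
have E r : \bigcap_i thickening (if (i : 'I_2) == ord0 then P else Q) r =
    thickening P r `&` thickening Q r.
  apply/seteqP; split=> [x Hx|x [Px Qx] i _]; last by case: ifP.
  by split; [exact: (Hx ord0)|exact: (Hx ord_max)].
by split=> d r /d; rewrite E.
Qed.

(** Only finitely many pairs of indices are involved, so the bounded sets
    attached to the pairs at a given radius can be merged into one. *)
Lemma gradually_disjointP k (A : 'I_k -> set X) : gradually_disjoint A <->
  trivIset setT A /\ forall i j, i != j -> pair_diverges (A i) (A j).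
Proof.
split=> -[tA dA]; split=> //.
  move=> i j /eqP ij r r0; have [B bB tB] := dA r r0.
  apply: metric_boundedS bB => x [xi xj]; apply: contrapT => nBx.
  by apply: ij; apply: tB => //; exists x.
move=> r r0; pose B (p : 'I_k * 'I_k) := if p.1 == p.2 then set0 else
  thickening (A p.1) r `&` thickening (A p.2) r.
exists (\bigcup_p B p).
  apply: metric_bounded_bigcup => -[i j]; rewrite /B /=.
  case: eqVneq => [_|ij]; first exact: metric_bounded0.
  exact: dA.
move=> i j _ _ [x [[xi nBx] [xj _]]]; apply: contrapT => /eqP/negbTE ij.
by apply: nBx; exists (i, j) => //; rewrite /B /= ij.
Qed.

End BoundedSets.

Lemma coarse_image_bounded (R : realType) (X Y : metricType R) (f : X -> Y) B :
  coarse f -> metric_bounded B -> metric_bounded (f @` B).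
Proof.
move=> [_ cf] [r Br]; have [|s _ fs] := cf (Num.max r 1).
  by rewrite lt_max ltr01 orbT.
exists s => _ _ [x Bx <-] [y By <-]; apply: fs.
by rewrite le_max Br.
Qed.

(** * Coarsely n-to-1 maps and gradually disjoint families *)

Section CoarselyNto1.
Variables (R : realType) (X Y : metricType R) (n : nat) (f : X -> Y).
Hypothesis cf : coarse f.

(** By pigeonhole, a [y] close to every [f @` A i] comes from two sets [A i] and
    [A j] at points within [s] of each other; such points fill a bounded set [E],
    so the [y] in question stay near [f @` E]. *)
Lemma coarsely_n_to_1_gradually_disjoint k (A : 'I_k -> set X) :
  coarsely_n_to_1 n f -> gradually_disjoint A ->
  ~ diverges (fun i => f @` A i) -> (k <= n)%N.
Proof.
move=> fn /gradually_disjointP[_ dA] nd; rewrite leqNgt; apply/negP => kn.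
apply: nd => r r0; have [|s s0 fs] := fn (r + 1 + (r + 1)); first by lra.
pose E (p : 'I_k * 'I_k) := if p.1 == p.2 then set0 else
  thickening (A p.1) s `&` thickening (A p.2) s.
have bE : metric_bounded (\bigcup_p E p).
  apply: metric_bounded_bigcup => -[i j]; rewrite /E /=.
  case: eqVneq => [_|ij]; first exact: metric_bounded0.
  exact: dA.
have := metric_bounded_thickening (r + 1) (coarse_image_bounded cf bE).
apply: metric_boundedS => y yA.
have [|m mn [U dU fU]] := fs [set z | mdist y z <= r + 1].
  by apply: diam_ball; lra.
have /choice[a aP] i : exists a, A i a /\ mdist y (f a) <= r + 1.
  by have [_ [a Aa <-] ya] := thickening_near (yA i I); exists a.
have /choice[g gU] i : exists j : 'I_m, U j (a i).
  by have [j _ ?] := fU (a i) (aP i).2; exists j.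
have /injectivePn[i [j ij gij]] : ~~ injectiveb g.
  apply/injectiveP => /leq_card; rewrite !card_ord leqNgt.
  by rewrite (leq_ltn_trans mn kn).
have aij : mdist (a i) (a j) <= s.
  have /(diam_leP _ (ltW s0)) Ui := dU (g i).
  by apply: Ui => //; rewrite gij.
apply: (@mem_thickening _ _ _ _ _ (f (a i))); last exact: (aP i).2.
exists (a i) => //; exists (i, j) => //; rewrite /E /= (negbTE ij); split.
  by apply: mem_thickening (aP i).1 _; rewrite mdistxx ltW.
exact: mem_thickening (aP j).1 aij.
Qed.

(** Greedy choice: while at most [n] points have been chosen, the balls of
    radius [s] around them cannot cover [S], so a further point can be added. *)
Lemma separated_points (S : set X) (s : R) : 0 <= s ->
  (forall m (U : 'I_m -> set X), (m <= n)%N ->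
     (forall i, (diam (U i) <= (s + s)%:E)%E) -> ~ S `<=` \bigcup_i U i) ->
  exists x : 'I_n.+1 -> X, (forall i, S (x i)) /\
    forall i j, i != j -> s < mdist (x i) (x j).
Proof.
move=> s0 nS.
have tP m : (m <= n.+1)%N -> exists t : seq X, [/\ size t = m,
    forall x, x \in t -> S x & pairwise (fun a b => s < mdist a b) t].
  elim: m => [_|m IH mn]; first by exists [::].
  have [t [szt St pt]] := IH (ltnW mn).
  have [x Sx xt] : exists2 x, S x & forall a, a \in t -> s < mdist x a.
    apply: contrapT => nx; pose U (i : 'I_m) :=
      [set y | mdist (tnth (in_tuple t) (cast_ord (esym szt) i)) y <= s].
    apply: (nS m U) => //.
      by move=> i; exact: diam_ball.
    move=> x Sx; apply: contrapT => nU; apply: nx; exists x => // a ta.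
    rewrite ltNge; apply/negP => xa; apply: nU.
    have ia : (index a t < m)%N by rewrite -szt index_mem.
    exists (Ordinal ia) => //.
    by rewrite /U /mkset (tnth_nth a) /= nth_index // metric_sym.
  exists (x :: t); split; first by rewrite /= szt.
  - by move=> y; rewrite inE => /orP[/eqP->|/St].
  - by rewrite /= pt andbT; apply/allP => a /xt.
have [t [szt St pt]] := tP _ (leqnn n.+1).
have [x0 _] : exists x0, x0 \in t.
  by case: (t) szt => // x u _; exists x; rewrite mem_head.
exists (fun i => nth x0 t i); split=> [i|].
  by apply: St; rewrite mem_nth // szt.
have sep (i j : 'I_n.+1) : (i < j)%N -> s < mdist (nth x0 t i) (nth x0 t j).
  by move=> ij; move/(pairwiseP x0): pt; apply; rewrite ?inE ?szt.
move=> i j; rewrite -val_eqE neq_ltn => /orP[/sep //|/sep].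
by rewrite metric_sym.
Qed.

End CoarselyNto1.

Section SparseSequence.
Variables (R : realType) (X : metricType R) (I : finType) (x : nat -> I -> X).

Definition escapes := forall B, metric_bounded B ->
  exists M, forall m i, (M <= m)%N -> ~ B (x m i).

(** Each new stage is chosen further from the base point [o] than all the
    earlier ones, by a margin that grows with [l]; comparing distances to [o]
    then separates the stages. *)
Lemma sparse_subsequence (o : X) : escapes ->
  exists2 sigma : nat -> nat, (forall l, l <= sigma l)%N &
    forall l q i j, (q < l)%N -> l%:R < mdist (x (sigma l) i) (x (sigma q) j).
Proof.
move=> ex.
have /choice[M MP] t : exists M, (t <= M)%N /\
    forall i, t%:R < mdist o (x M i).
  have [M MP] := ex _ (metric_bounded_ball o t%:R).
  exists (maxn t M); split=> [|i]; first exact: leq_maxl.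
  by rewrite ltNge; apply/negP; apply: MP; exact: leq_maxr.
have /choice[K KP] m : exists K, forall i, mdist o (x m i) <= K%:R.
  exists (Num.bound (\big[Num.max/0]_i mdist o (x m i))) => i.
  apply: le_trans (ltW (archi_boundP _)); first exact: le_bigmax.
  by apply/bigmax_geP; left.
(* Stage [m] lies within [K m] of [o], and stage [M t] lies beyond [t]. *)
pose sigma := nat_rect (fun=> nat) 0%N (fun l s => M (K s + l.+1)%N).
exists sigma => [[//|l]|l q i j ql].
  by apply: leq_trans (MP _).1; exact: leq_addl.
have far : forall i, (K (sigma q) + l)%:R < mdist o (x (sigma l) i).
  elim: l ql => // l IH; rewrite ltnS leq_eqVlt => /orP[/eqP-> i'|/IH{}IH i'].
    exact: (MP _).2.
  apply: le_lt_trans ((MP _).2 i'); rewrite ler_nat leq_add //.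
  rewrite -(ler_nat R); apply: le_trans (KP (sigma l) i').
  by apply: le_trans (ltW (IH i')); rewrite ler_nat leq_addr.
have := far i; have := KP (sigma q) j; rewrite natrD.
have := metric_triangle o (x (sigma q) j) (x (sigma l) i).
by rewrite (metric_sym (x (sigma l) i)); lra.
Qed.

End SparseSequence.

Section CoarselyNto1Converse.
Variables (R : realType) (X Y : metricType R) (n : nat) (f : X -> Y).
Hypotheses (cf : coarse f) (n_gt0 : (0 < n)%N).

(** If one coordinate of [x m] lay in a bounded set, all the images, being
    mutually close, would lie in a bounded set, and by properness so would all
    the coordinates; this bounds [m], since for [n > 0] there are two distinct
    coordinates at distance more than [m]. *)
Lemma separated_fibres_escape (r : R) (x : nat -> 'I_n.+1 -> X) :
  (forall m i j, i != j -> m%:R < mdist (x m i) (x m j)) ->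
  (forall m i j, mdist (f (x m i)) (f (x m j)) <= r) -> escapes x.
Proof.
move=> sepx fx B bB.
have := metric_bounded_thickening r (coarse_image_bounded cf bB).
move=> /cf.1[s sB]; exists (Num.bound s) => m i sm Bi.
have fB j : thickening (f @` B) r (f (x m j)).
  by apply: (@mem_thickening _ _ _ _ _ (f (x m i))) => //; exists (x m i).
have /sepx : ord0 != ord_max :> 'I_n.+1 by rewrite -val_eqE /= neq_ltn n_gt0.
move=> /(_ m); have Bi' := fB ord0; have := sB _ _ (fB ord0) (fB ord_max).
have : (Num.bound s)%:R <= m%:R :> R by rewrite ler_nat.
have s0 : 0 <= s by apply: le_trans (sB _ _ Bi' Bi'); exact: mdist_ge0.
have := archi_boundP s0; lra.
Qed.

(** A failure of the covering property yields [n + 1] gradually disjoint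
    sequences whose images run at distance at most [r] from each other. *)
Lemma gradually_disjoint_coarsely_n_to_1 :
  (forall (k : nat) (A : 'I_k -> set X),
     gradually_disjoint A -> ~ diverges (fun i => f @` A i) -> (k <= n)%N) ->
  coarsely_n_to_1 n f.
Proof.
move=> gd r r0; apply: contrapT => nf.
have /choice[x xP] (m : nat) : exists x : 'I_n.+1 -> X,
    (forall i j, i != j -> m%:R < mdist (x i) (x j)) /\
    forall i j, mdist (f (x i)) (f (x j)) <= r.
  (* Radius [m.+1] rather than [m], because the size must be positive. *)
  have [A dA nA] : exists2 A : set Y, (diam A <= r%:E)%E &
      forall k (U : 'I_k -> set X), (k <= n)%N ->
        (forall i, (diam (U i) <= (m.+1%:R + m.+1%:R)%:E)%E) ->
        ~ f @^-1` A `<=` \bigcup_i U i.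
    apply: contrapT => nA; apply: nf; exists (m.+1%:R + m.+1%:R) => [|A dA].
      by rewrite addr_gt0.
    apply: contrapT => nU; apply: nA; exists A => // k U kn dU fU.
    by apply: nU; exists k => //; exists U.
  have [x [Ax sepx]] := separated_points (ler0n _ _) nA.
  exists x; split=> [i j /sepx|i j]; first by apply: lt_trans; rewrite ltr_nat.
  by have /(diam_leP _ (ltW r0)) := dA; apply; exact: Ax.
have ex : escapes x.
  by apply: (@separated_fibres_escape r) => m i j; [exact: (xP m).1|exact: (xP m).2].
have [sigma sigma_ge sigma_far] := sparse_subsequence (x 0 ord0) ex.
pose y l i := x (sigma l) i.
have sepy l q i j : i != j -> (maxn l q)%:R < mdist (y l i) (y q j).
  move=> ij; have [ql|lq|<-] := ltngtP q l.
  - exact: sigma_far.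
  - by rewrite metric_sym; exact: sigma_far.
  - by apply: le_lt_trans ((xP _).1 i j ij); rewrite ler_nat.
suff : (n.+1 <= n)%N by rewrite ltnn.
apply: (gd _ (fun i => range (y^~ i))).
  apply/gradually_disjointP; split.
    move=> i j _ _ [_ [[l _ <-] [q _ yij]]]; apply/eqP; apply: contrapT => /negP ij.
    have := sepy l q i j ij; rewrite yij mdistxx.
    by rewrite ltNge ler0n.
  (* A point within s of two of the sequences is near terms whose distance is at
     most 2(s + 1), and sparseness leaves finitely many such terms. *)
  move=> i j ij s s0; pose T := Num.bound (s + 1 + (s + 1)).
  pose B (p : 'I_T.+1 * 'I_n.+1) := thickening [set y p.1 p.2] (s + 1).
  apply: (@metric_boundedS _ _ _ (\bigcup_p B p)).
    move=> z [/thickening_near[_ [l _ <-] zl] /thickening_near[_ [q _ <-] zq]].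
    have lT : (l < T.+1)%N.
      rewrite ltnS -(ler_nat R).
      have : l%:R <= (maxn l q)%:R :> R by rewrite ler_nat leq_maxl.
      have := sepy l q i j ij.
      have := metric_triangle (y l i) z (y q j); rewrite (metric_sym _ z).
      have : s + 1 + (s + 1) < T%:R.
        by apply: archi_boundP; rewrite !addr_ge0 // ltW.
      lra.
    exists (Ordinal lT, i) => //; exact: mem_thickening zl.
  apply: metric_bounded_bigcup => p; apply: metric_bounded_thickening.
  exact: metric_bounded1.
move=> /(_ r r0) /cf.1[s sy].
have yr l : (f @^-1` \bigcap_i thickening (f @` range (y^~ i)) r) (y l ord0).
  move=> i _; apply: (@mem_thickening _ _ _ _ _ (f (y l i))).
    by exists (y l i) => //; exists l.
  exact: (xP _).2.
have := sy _ _ (yr (Num.bound s).+1) (yr 0%N).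
have := sigma_far (Num.bound s).+1 0%N ord0 ord0 isT.
have s0 : 0 <= s by apply: le_trans (sy _ _ (yr 0%N) (yr 0%N)); exact: mdist_ge0.
have := archi_boundP s0; rewrite /y -natr1; lra.
Qed.

End CoarselyNto1Converse.

(** * Higson functions *)

Section ComplexDistance.
Variable R : realType.
Implicit Types z w : R[i].

Lemma mdist_real (a b : R) : mdist a%:C%C b%:C%C = `|a - b|.
Proof.
rewrite /mdist /= /complex_dist -rmorphB /= /ComplexField.Normc.normc /=.
by rewrite expr0n addr0 sqrtr_sqr.
Qed.

Lemma mdist_Re z w : `|complex.Re z - complex.Re w| <= mdist z w.
Proof.
case: z w => [a b] [c d]; rewrite /mdist /= /complex_dist /=.
by rewrite -sqrtr_sqr ler_sqrt ?lerDl ?addr_ge0 ?sqr_ge0.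
Qed.

Lemma mdist_Im z w : `|complex.Im z - complex.Im w| <= mdist z w.
Proof.
case: z w => [a b] [c d]; rewrite /mdist /= /complex_dist /=.
by rewrite -sqrtr_sqr ler_sqrt ?lerDr ?addr_ge0 ?sqr_ge0.
Qed.

Lemma mdist_le_ReIm z w : mdist z w <=
  `|complex.Re z - complex.Re w| + `|complex.Im z - complex.Im w|.
Proof.
case: z w => [a b] [c d]; rewrite /mdist /= /complex_dist /=.
set x := a - c; set y := b - d.
rewrite -[leRHS]ger0_norm ?addr_ge0 // -sqrtr_sqr ler_sqrt ?sqr_ge0 //.
rewrite [leRHS]sqrrD !real_normK ?num_real //.
have : 0 <= `|x| * `|y| by rewrite mulr_ge0.
by rewrite mulr2n; lra.
Qed.

End ComplexDistance.

Section HigsonFunctions.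
Variables (R : realType) (X : metricType R).

(** The oscillation condition for pairs of points rather than balls: two points
    of one ball are at bounded distance, and conversely a pair of close points
    lies in the ball around its first member. *)
Lemma slowly_oscillatingP (phi : X -> R[i]) : slowly_oscillating phi <->
  forall r e : R, 0 < r -> 0 < e -> exists2 B, metric_bounded B &
    forall x y, ~ B x -> ~ B y -> mdist x y <= r -> mdist (phi x) (phi y) <= e.
Proof.
split=> sphi r e r0 e0.
  have [B bB phiB] := sphi r e r0 e0; exists B => // x y Bx By xy.
  have /(diam_leP _ (ltW e0)) := phiB x; apply.
    exists x => //; split => //.
    by apply: (@mem_thickening _ _ _ _ _ x); rewrite // mdistxx ltW.
  exists y => //; split => //.
  by apply: (@mem_thickening _ _ _ _ _ x); rewrite // metric_sym.
have [|B bB phiB] := sphi (r + 1 + (r + 1)) e _ e0; first by lra.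
exists B => // x; apply/diam_leP; first exact: ltW.
move=> _ _ [a [ax Ba] <-] [b [bx Bb] <-].
apply: phiB => //.
have [_ -> ax'] := thickening_near ax; have [_ -> bx'] := thickening_near bx.
by have := metric_triangle a x b; rewrite (metric_sym x b); lra.
Qed.

Lemma real_higson_function (g : X -> R) : topologically_discrete X ->
  (exists M, forall x, `|g x| <= M) ->
  (forall r e : R, 0 < r -> 0 < e -> exists2 B, metric_bounded B &
    forall x y, ~ B x -> ~ B y -> mdist x y <= r -> `|g x - g y| <= e) ->
  (fun x => (g x)%:C%C) \in higson_functions X.
Proof.
move=> dX [M gM] osc; apply/mem_set; split.
- exists (M + M) => _ _ [x _ <-] [y _ <-]; rewrite mdist_real.
  by apply: le_trans (ler_normB _ _) _; apply: lerD.
- exact: discrete_continuous.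
- apply/slowly_oscillatingP => r e r0 e0; have [B bB gB] := osc r e r0 e0.
  by exists B => // x y Bx By xy; rewrite mdist_real; exact: gB.
Qed.

Lemma nbhs_higson_coord (phi : higson_functions X) (p : higson X) (e : R) :
  0 < e -> nbhs p [set q | mdist (val (val p phi)) (val (val q phi)) < e].
Proof.
move=> e0; have c := @higson_coord_continuous R X phi p.
have /c : nbhs (val (val p phi)) (ball (val (val p phi)) e).
  exact: nbhsx_ballx.
by rewrite ballEmdist.
Qed.

(** On the traces of the two neighbourhoods a separating Higson function differs
    by more than [d], whereas far out it varies by at most [d] at any given
    scale; hence the traces are coarsely apart. *)
Lemma higson_separation (p q : higson X) : p <> q ->
  exists P Q : set (higson X), [/\ nbhs p P, nbhs q Q,
    @higson_embed R X @^-1` P `&` @higson_embed R X @^-1` Q = set0 &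
    pair_diverges (@higson_embed R X @^-1` P) (@higson_embed R X @^-1` Q)].
Proof.
move=> pq; have [phi pqphi] : exists phi : higson_functions X,
    val (val p phi) <> val (val q phi).
  by apply: contrapT => /forallNP pqE; apply: pq; apply: higson_eqP => phi;
    apply: contrapT; exact: pqE.
pose zp : R[i] := val (val p phi); pose zq : R[i] := val (val q phi).
have d0 : 0 < mdist zp zq / 3 by rewrite divr_gt0 // mdist_gt0; exact/eqP.
(* The factor 3 leaves a gap of d between the d-neighbourhoods of the values. *)
set d := mdist zp zq / 3 in d0.
have dE : mdist zp zq = d * 3 by rewrite divfK.
have far x y : mdist zp (val phi x) < d -> mdist zq (val phi y) < d ->
    d < mdist (val phi x) (val phi y).
  move=> px qy; have := metric_triangle zp (val phi x) zq.
  have := metric_triangle (val phi x) (val phi y) zq.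
  by rewrite (metric_sym (val phi y)); lra.
exists [set u | mdist zp (val (val u phi)) < d].
exists [set u | mdist zq (val (val u phi)) < d].
split; [exact: nbhs_higson_coord|exact: nbhs_higson_coord|..].
  apply/seteqP; split=> // x [xp xq]; have := far x x xp xq.
  by rewrite mdistxx; lra.
move=> r r0; have /set_mem [_ _ /slowly_oscillatingP sphi] := valP phi.
have [|B bB phiB] := sphi (r + 1 + (r + 1)) d _ d0; first by lra.
apply: metric_boundedS (metric_bounded_thickening (r + 1) bB).
move=> x [/thickening_near[a ap xa] /thickening_near[b bq xb]].
have [Ba|Ba] := pselect (B a); first exact: mem_thickening xa.
have [Bb|Bb] := pselect (B b); first exact: mem_thickening xb.
have : mdist (val phi a) (val phi b) <= d.
  apply: phiB => //.
  by have := metric_triangle a x b; rewrite (metric_sym a x); lra.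
by have := far a b ap bq; lra.
Qed.

End HigsonFunctions.

(** * The weights of a diverging family *)

Section DivergingFamily.
Variables (R : realType) (X : metricType R).
Hypothesis dX : topologically_discrete X.

Lemma dist_to_fin (A : set X) x : A !=set0 ->
  ((fine (dist_to x A))%:E = dist_to x A /\ 0 <= fine (dist_to x A)).
Proof.
move=> [a Aa]; have d0 : (0 <= dist_to x A)%E.
  by apply: le_ereal_inf_tmp => _ [b _ <-]; rewrite lee_fin mdist_ge0.
split; last exact: fine_ge0.
rewrite fineK // ge0_fin_numE //.
apply: le_lt_trans (ltry (mdist x a)).
by apply: ge_ereal_inf; exists (mdist x a)%:E => //; exists a.
Qed.

Lemma fine_dist_to_lipschitz (A : set X) x y : A !=set0 ->
  `|fine (dist_to x A) - fine (dist_to y A)| <= mdist x y.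
Proof.
move=> A0; suff H u v : fine (dist_to u A) <= mdist u v + fine (dist_to v A).
  by have := H x y; have := H y x; rewrite (metric_sym y x) ler_norml; lra.
rewrite -lee_fin EFinD (dist_to_fin u A0).1 (dist_to_fin v A0).1 -leeBlDl //.
apply: le_ereal_inf_tmp => _ [a Aa <-]; rewrite leeBlDl // -EFinD.
apply: ge_ereal_inf; exists (mdist u a)%:E; first by exists a.
by rewrite lee_fin metric_triangle.
Qed.

Variables (k : nat) (C : 'I_k -> set X).
Hypothesis C0 : forall i, C i !=set0.
Hypothesis dC : diverges C.

Let d i x := fine (dist_to x (C i)).
Let s x := \sum_i d i x.

Let d_ge0 i x : 0 <= d i x. Proof. by case: (dist_to_fin x (C0 i)). Qed.

Let d_le_s i x : d i x <= s x.
Proof. by rewrite /s (bigD1 i) //= lerDl sumr_ge0. Qed.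

Let s_ge0 x : 0 <= s x. Proof. exact: sumr_ge0. Qed.

(** Adding 1 to the denominator avoids a case distinction at common points of the
    [C i]; the weights then sum to [s x / (1 + s x)], which tends to 1. *)
Definition distance_weight i x := d i x / (1 + s x).

Lemma distance_weight0 i x : C i x -> distance_weight i x = 0.
Proof.
move=> Cx; rewrite /distance_weight.
suff -> : d i x = 0 by rewrite mul0r.
apply/eqP; rewrite eq_le d_ge0 andbT -lee_fin (dist_to_fin x (C0 i)).1.
by apply: ge_ereal_inf; exists 0%E => //; exists x => //; rewrite mdistxx.
Qed.

(** The points where [s] is at most [M] lie in the [M]-thickening of every [C i],
    so divergence makes the total distance tend to infinity. *)
Lemma sum_dist_to_gt (M : R) : 0 < M -> exists2 B, metric_bounded B &
  forall x, ~ B x -> M < s x.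
Proof.
move=> M0; exists (\bigcap_i thickening (C i) M); first exact: dC.
move=> x nB; rewrite ltNge; apply/negP => sM; apply: nB => i _.
rewrite /thickening /= -(dist_to_fin x (C0 i)).1 lee_fin.
exact: le_trans (d_le_s i x) sM.
Qed.

Lemma sum_distance_weight_ge : exists2 B, metric_bounded B &
  forall x, ~ B x -> 1 / 2 <= \sum_i distance_weight i x.
Proof.
have [B bB sB] := sum_dist_to_gt ltr01.
exists B => // x /sB s1; rewrite -mulr_suml -/(s x).
by rewrite ler_pdivlMr; lra.
Qed.

(** The numerators are 1-Lipschitz and the denominator is k-Lipschitz, so at scale
    [r] a weight varies by at most [r (1 + k) / (1 + s x)], which is small where
    [s] is large. *)
Lemma distance_weight_higson i :
  (fun x => (distance_weight i x)%:C%C) \in higson_functions X.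
Proof.
have S0 x : 0 < 1 + s x by rewrite ltr_wpDr.
have w01 x : 0 <= distance_weight i x <= 1.
  rewrite divr_ge0 ?d_ge0 ?(ltW (S0 x)) //= ler_pdivrMr // mul1r.
  by rewrite ler_wpDl.
apply: real_higson_function => //.
  by exists 1 => x; have /andP[w0 w1] := w01 x; rewrite ger0_norm.
move=> r e r0 e0.
have M0 : 0 < r * (1 + k%:R) / e by rewrite divr_gt0 // mulr_gt0 // ltr_wpDr.
have [B bB sB] := sum_dist_to_gt M0.
exists B => // x y /sB sx _ xy.
have dxy j : `|d j x - d j y| <= r.
  exact: le_trans (fine_dist_to_lipschitz x y (C0 j)) xy.
have sxy : `|s y - s x| <= r * k%:R.
  rewrite distrC /s -sumrB; apply: le_trans (ler_norm_sum _ _ _) _.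
  apply: le_trans (ler_sum _ (fun j _ => dxy j)) _.
  by rewrite sumr_const card_ord mulr_natr.
have -> : distance_weight i x - distance_weight i y =
    ((d i x - d i y) + distance_weight i y * (s y - s x)) / (1 + s x).
  rewrite /distance_weight; field.
  by have := S0 x; have := S0 y; lra.
rewrite normrM normfV (gtr0_norm (S0 x)) ler_pdivrMr //.
apply: le_trans (ler_normD _ _) _; rewrite normrM.
have wy : `|distance_weight i y| <= 1.
  by have /andP[w0 w1] := w01 y; rewrite ger0_norm.
have := ler_pM (normr_ge0 _) (normr_ge0 _) wy sxy; rewrite mul1r => h.
have := dxy i; move: sx; rewrite ltr_pdivrMr // => sx dx.
nra.
Qed.

End DivergingFamily.

(** * Closures in the corona *)

Section Corona.
Variables (R : realType) (X : metricType R).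
Hypotheses (pX : proper_space X) (dX : topologically_discrete X).

(** Bounded sets are finite, so their images are closed. *)
Lemma corona_off_bounded (p : higson X) B : ~ range (@higson_embed R X) p ->
  metric_bounded B -> nbhs p (~` (@higson_embed R X @` B)).
Proof.
move=> pE bB; apply: open_nbhs_nbhs; split; last first.
  by move=> [x _ xp]; apply: pE; exists x.
apply: closed_openC.
have /accessible_finite_set_closed : accessible_space (higson X).
  exact/hausdorff_accessible/higson_hausdorff.
by apply; apply: finite_image; exact: bounded_finite.
Qed.

(** Near a common point of the closures all the weights are small, since each
    vanishes on its own [C i]; but near a corona point there are points of [X]
    outside any given bounded set, and there the weights add up to at least 1/2. *)
Lemma corona_closures_not_diverge k (C : 'I_k -> set X) (p : higson X) :
  ~ range (@higson_embed R X) p ->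
  (forall i, closure (@higson_embed R X @` C i) p) -> ~ diverges C.
Proof.
move=> pE clC dC.
have C0 i : C i !=set0.
  by have [_ [[x Cx _] _]] := clC i setT filterT; exists x.
have [B bB wB] := sum_distance_weight_ge C0 dC.
pose phi i : higson_functions X :=
  exist (fun h => h \in higson_functions X) _ (distance_weight_higson dX C0 dC i).
(* Then k weights of size at most 2e add up to less than 1/2. *)
pose e : R := (4 * (k%:R + 1))^-1.
have e0 : 0 < e by rewrite invr_gt0 mulr_gt0 // ltr_wpDl.
pose V i := [set q : higson X |
  mdist (val (val p (phi i))) (val (val q (phi i))) < e].
have Vp i : nbhs p (V i) := nbhs_higson_coord (phi i) p e0.
have : nbhs p (~` (@higson_embed R X @` B) `&` [set q | forall i, V i q]).
  apply: filterI; first exact: corona_off_bounded.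
  exact: (@filter_forall _ _ V _ (nbhs_filter p) Vp).
move=> /higson_embed_dense[_ [[x _ <-] [nBx Vx]]].
have Bx : ~ B x by move=> Bx; apply: nBx; exists x.
have wx i : distance_weight C i x <= e + e.
  have [_ [[c Cc <-] Vc]] := clC i (V i) (Vp i).
  have := metric_triangle (val (phi i) c) (val (val p (phi i))) (val (phi i) x).
  rewrite [leLHS]mdist_real (distance_weight0 C0 Cc) sub0r normrN => wx.
  apply: le_trans (ler_norm _) _; apply: le_trans wx _.
  by apply: lerD; apply: ltW; [rewrite metric_sym; exact: Vc|exact: Vx].
have := wB x Bx.
have : \sum_i distance_weight C i x <= k%:R * (e + e).
  apply: le_trans (ler_sum _ (fun i _ => wx i)) _.
  by rewrite sumr_const card_ord mulr_natl.
have : k%:R * (e + e) < 1 / 2 :> R.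
  have k0 : 0 < k%:R + 1 :> R by rewrite ltr_wpDl.
  have -> : k%:R * (e + e) = k%:R / (k%:R + 1) / 2 by rewrite /e; field; lra.
  by rewrite ltr_pM2r ?invr_gt0 // ltr_pdivrMr //; lra.
lra.
Qed.

End Corona.

(** * Limits along ultrafilters *)

Section UltrafilterLimits.
Variable R : realType.

Lemma ultra_fmap (T U : Type) (F : set_system T) (g : T -> U) :
  UltraFilter F -> UltraFilter (g @ F).
Proof.
move=> FU; split=> [|G GF FG]; first exact: fmap_proper_filter.
apply/seteqP; split=> // A GA.
have [//|FnA] := in_ultra_setVsetC (g @^-1` A) FU.
have GnA : G (~` A) by exact: FG.
by have [x []] := filter_ex (filterI GA GnA).
Qed.

Lemma bounded_ultra_cvg_real (T : Type) (F : set_system T) (g : T -> R) (M : R) :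
  UltraFilter F -> (forall t, `|g t| <= M) ->
  exists a : R, forall e : R, 0 < e -> F [set t | `|a - g t| < e].
Proof.
move=> FU gM; have := @segment_compact R (- M) M; rewrite compact_ultra.
move=> /(_ (g @ F) (ultra_fmap g FU)) [|a [_ ga]].
  by apply: (@filterE _ F) => t; rewrite /= in_itv /= -ler_norml.
by exists a => e e0; have /cvgrPdist_lt/(_ e e0) := ga.
Qed.

Lemma bounded_ultra_cvg (T : Type) (F : set_system T) (g : T -> R[i]) :
  UltraFilter F -> metric_bounded (range g) ->
  exists z : R[i], g @ F --> z.
Proof.
move=> FU [M gM].
have [t0 _] := filter_ex (@filterT _ F _).
have gM' t : mdist (g t) (g t0) <= M by apply: gM; [exists t|exists t0].
have bRe t : `|complex.Re (g t)| <= M + `|complex.Re (g t0)|.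
  have := mdist_Re (g t) (g t0); have := gM' t.
  have := ler_normD (complex.Re (g t) - complex.Re (g t0)) (complex.Re (g t0)).
  by rewrite subrK; lra.
have bIm t : `|complex.Im (g t)| <= M + `|complex.Im (g t0)|.
  have := mdist_Im (g t) (g t0); have := gM' t.
  have := ler_normD (complex.Im (g t) - complex.Im (g t0)) (complex.Im (g t0)).
  by rewrite subrK; lra.
have [a aF] := bounded_ultra_cvg_real FU bRe.
have [b bF] := bounded_ultra_cvg_real FU bIm.
exists (Complex a b); apply/cvg_ballP => e e0.
have e2 : 0 < e / 2 by rewrite divr_gt0.
rewrite near_map; near=> t; rewrite ballEmdist /=.
apply: le_lt_trans (mdist_le_ReIm _ _) _ => /=.
have : `|a - complex.Re (g t)| < e / 2 by near: t; exact: aF.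
have : `|b - complex.Im (g t)| < e / 2 by near: t; exact: bF.
lra.
Unshelve. all: by end_near.
Qed.

Lemma cvg_to_initial (S : choiceType) (T : topologicalType) (h : S -> T)
    (F : set_system S) (s : S) :
  Filter F -> h @ F --> h s -> F --> (s : initial_topology h).
Proof.
move=> FF hF A [_ [[B oB <-] Bs] sA]; apply: filterS sA _.
by apply: hF; exact: open_nbhs_nbhs.
Qed.

Variable X : metricType R.

(** A concrete form of the compactness of [higson X]: every coordinate is a bounded
    function, so it has a limit along the ultrafilter, and these limits are the
    coordinates of a point of the closure. *)
Lemma higson_ultra_cvg (T : Type) (F : set_system T) (g : T -> X) :
  UltraFilter F -> exists p : higson X, (@higson_embed R X \o g) @ F --> p.
Proof.
move=> FU.
have /choice[z zP] (phi : higson_functions X) :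
    exists z : R[i], (val phi \o g) @ F --> z.
  apply: bounded_ultra_cvg.
  have /set_mem[bphi _ _] := valP phi; apply: metric_boundedS bphi.
  by move=> _ [t _ <-]; exists (g t).
have zcl phi : z phi \in closure (range (val phi)).
  apply/mem_set => A zA.
  have /filter_ex[t At] : F ((val phi \o g) @^-1` A) by exact: zP.
  by exists (val phi (g t)); split => //; exists (g t).
pose q : higson_product X := fun phi =>
  exist (fun w => w \in closure (range (val phi))) _ (zcl phi).
have gq : (@higson_eval R X \o g) @ F --> q.
  apply/cvg_sup => phi; apply: cvg_to_initial; apply: cvg_to_initial; exact: zP.
have qcl : q \in closure (range (@higson_eval R X)).
  apply/mem_set => A qA.
  have /filter_ex[t At] : F ((@higson_eval R X \o g) @^-1` A) by exact: gq.
  by exists (higson_eval (g t)); split => //; exists (g t).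
exists (exist (fun w => w \in closure (range (@higson_eval R X))) _ qcl).
by apply: cvg_to_initial; exact: gq.
Qed.

End UltrafilterLimits.

(** * Fibres of the corona map *)

Section FiniteCardinality.

Lemma not_card_le_II (T : Type) (A : set T) n : ~ (A #<= `I_n) ->
  exists2 q : 'I_n.+1 -> T, injective q & forall i, A (q i).
Proof.
move=> An; have : [set: 'I_n.+1] #<= A.
  rewrite -(card_le_eql card_II).
  have [[m Am]|/infiniteP] := pselect (finite_set A).
    move/negP: An; rewrite (card_le_eql Am) (card_le_eqr Am) !card_le_II.
    by rewrite -ltnNge.
  by apply: card_le_trans; exact: card_leT.
move=> /card_leP[h]; exists (fun i => val (h (exist _ i (mem_set I)))).
  move=> i j /val_inj/(@inj _ _ setT h) hij.
  by have [] := hij (mem_set I) (mem_set I).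
by move=> i; exact: set_mem (valP (h _)).
Qed.

Lemma card_le_II_inj (T : Type) (A : set T) n k (p : 'I_k -> T) :
  A #<= `I_n -> injective p -> (forall i, A (p i)) -> (k <= n)%N.
Proof.
move=> An injp Ap; rewrite -card_le_II (card_le_eql card_II).
have <- : (range p #<= `I_n) = ([set: 'I_k] #<= `I_n).
  by apply: card_le_eql; apply: inj_card_eq => i j _ _; exact: injp.
by apply: card_le_trans An; apply: subset_card_le => _ [i _ <-].
Qed.

End FiniteCardinality.

Section CoronaMap.
Variables (R : realType) (X Y : metricType R).
Hypotheses (pX : proper_space X) (dX : topologically_discrete X).
Hypotheses (pY : proper_space Y) (dY : topologically_discrete Y).
Variables (n : nat) (f : X -> Y).
Hypothesis cf : coarse f.

(** Any [n + 1] corona points over [y] have neighbourhoods with gradually disjoint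
    traces; [y] lies in the closure of the image of every trace, so the images
    do not diverge. *)
Lemma gradually_disjoint_corona_n_to_1 :
  (forall (k : nat) (A : 'I_k -> set X),
     gradually_disjoint A -> ~ diverges (fun i => f @` A i) -> (k <= n)%N) ->
  n_to_1 n (corona_map pX dX dY cf).
Proof.
move=> gd y; apply: contrapT => /not_card_le_II[q injq qy].
have qv i j : i != j -> val (q i) <> val (q j).
  by move=> /eqP ij /val_inj/injq.
(* The case i = j is included only to make the choice total. *)
have /choice[PQ PQP] (ij : 'I_n.+1 * 'I_n.+1) :
    exists PQ : set (higson X) * set (higson X),
    [/\ nbhs (val (q ij.1)) PQ.1, nbhs (val (q ij.2)) PQ.2 & ij.1 != ij.2 ->
      @higson_embed R X @^-1` PQ.1 `&` @higson_embed R X @^-1` PQ.2 = set0 /\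
      pair_diverges (@higson_embed R X @^-1` PQ.1)
                    (@higson_embed R X @^-1` PQ.2)].
  case: ij => i j /=; have [->|/qv ij] := eqVneq i j.
    by exists (setT, setT); split => //; exact: filterT.
  by have [P [Q [? ? ? ?]]] := higson_separation ij; exists (P, Q); split.
pose V i j := (PQ (i, j)).1 `&` (PQ (j, i)).2.
have qV i : nbhs (val (q i)) [set u | forall j, V i j u].
  apply: (@filter_forall _ _ (V i) _ (nbhs_filter _)) => j; apply: filterI.
    by have [] := PQP (i, j).
  by have [] := PQP (j, i).
pose A i := @higson_embed R X @^-1` [set u | forall j, V i j u].
have AP i j : A i `<=` @higson_embed R X @^-1` (PQ (i, j)).1.
  by move=> x /(_ j)[].
have AQ i j : A j `<=` @higson_embed R X @^-1` (PQ (i, j)).2.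
  by move=> x /(_ i)[].
suff : (n.+1 <= n)%N by rewrite ltnn.
apply: (gd _ A).
  apply/gradually_disjointP; split=> [i j _ _ [x [Ax Ax']]|i j ij].
    apply/eqP; apply: contrapT => /negP ij.
    have [_ _ /(_ ij)[+ _]] := PQP (i, j).
    by move=> /seteqP[/(_ x) + _]; apply; split; [exact: AP Ax|exact: AQ Ax'].
  have [_ _ /(_ ij)[_]] := PQP (i, j).
  by apply: pair_divergesS; [exact: AP|exact: AQ].
apply: (@corona_closures_not_diverge R Y pY dY _ _ (val y)).
  exact: set_mem (valP y).
move=> i U; rewrite -(qy i) /= => Uq.
have /higson_embed_dense[_ [[x _ <-] [Ux Ax]]] : nbhs (val (q i))
    (higson_map dX cf @^-1` U `&` [set u | forall j, V i j u]).
  by apply: filterI (qV i); exact: higson_map_continuous.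
exists (higson_embed (f x)); split; first by exists (f x) => //; exists x.
by rewrite -(higson_map_embed dX cf).
Qed.

(** If the limit were the image of a point [z], the indicator function of [z], which
    is a Higson function, would force [g] to take the value [z] on a set of the
    ultrafilter. *)
Lemma ultra_limit_far (T : Type) (F : set_system T) (Z : metricType R)
    (g : T -> Z) (p : higson Z) : topologically_discrete Z -> UltraFilter F ->
  (forall B, metric_bounded B -> ~ F (g @^-1` B)) ->
  (@higson_embed R Z \o g) @ F --> p -> ~ range (@higson_embed R Z) p.
Proof.
move=> dZ FU gB gp [z _ zp].
pose phi : higson_functions Z :=
  exist (fun h => h \in higson_functions Z) _ (dirac_fun_higson dZ z).
have Fp : F ((@higson_embed R Z \o g) @^-1`
    [set u | mdist (val (val p phi)) (val (val u phi)) < 1]).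
  exact: (gp _ (nbhs_higson_coord phi p ltr01)).
apply: (gB _ (metric_bounded1 z)); apply: filterS Fp => t.
rewrite -zp /= /dirac_fun eqxx; case: eqP => // _.
by rewrite /mdist /= /complex_dist subr0 ComplexField.Normc.normc1 ltxx.
Qed.

(** Two maps that leave every bounded set at bounded distance from each other have
    the same limit, because no Higson function tells them apart far out. *)
Lemma higson_limit_close (T : Type) (F : set_system T) (g h : T -> Y) (r : R)
    (p q : higson Y) : ProperFilter F -> 0 < r ->
  F [set t | mdist (g t) (h t) <= r] ->
  (forall B, metric_bounded B -> F (~` (g @^-1` B))) ->
  (forall B, metric_bounded B -> F (~` (h @^-1` B))) ->
  (@higson_embed R Y \o g) @ F --> p -> (@higson_embed R Y \o h) @ F --> q ->
  p = q.
Proof.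
move=> FF r0 ghr gB hB gp hq; apply: higson_eqP => phi; apply/eqP.
rewrite -[_ == _]negbK -mdist_gt0; apply/negP => d0.
set d := mdist _ _ in d0; have d3 : 0 < d / 3 by rewrite divr_gt0.
have /set_mem [_ _ /slowly_oscillatingP/(_ r _ r0 d3)[B bB phiB]] := valP phi.
have gpF : F [set t | mdist (val (val p phi)) (val phi (g t)) < d / 3].
  exact: (gp _ (nbhs_higson_coord phi p d3)).
have hqF : F [set t | mdist (val (val q phi)) (val phi (h t)) < d / 3].
  exact: (hq _ (nbhs_higson_coord phi q d3)).
have [t [[[[/= gpt hqt] ght] gBt] hBt]] :=
  filter_ex (filterI (filterI (filterI (filterI gpF hqF) ghr) (gB B bB)) (hB B bB)).
have := phiB _ _ gBt hBt ght.
have := metric_triangle (val (val p phi)) (val phi (g t)) (val (val q phi)).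
have := metric_triangle (val phi (g t)) (val phi (h t)) (val (val q phi)).
rewrite (metric_sym (val phi (h t)) (val (val q phi))) -/d.
lra.
Qed.

(** Along an ultrafilter of unbounded subsets of [D], selections of points of the
    [A i] over points near [y] in [D] have limits in the corona of [X].  They lie
    over the limit of the [y], and no two agree, since the [A i] diverge
    pairwise. *)
Lemma corona_n_to_1_gradually_disjoint k (A : 'I_k -> set X) :
  n_to_1 n (corona_map pX dX dY cf) -> gradually_disjoint A ->
  ~ diverges (fun i => f @` A i) -> (k <= n)%N.
Proof.
move=> fn /gradually_disjointP[_ dA] nd.
have [r r0 nbD] : exists2 r, 0 < r &
    ~ metric_bounded (\bigcap_i thickening (f @` A i) r).
  by apply: contrapT => nr; apply: nd => r r0; apply: contrapT => nb; apply: nr;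
    exists r.
pose D := \bigcap_i thickening (f @` A i) r.
(* The filter of sets that contain D up to a bounded set. *)
pose F0 : set_system Y := [set S | metric_bounded (D `\` S)].
have PF0 : ProperFilter F0.
  split; first by rewrite /F0 /= setD0.
  split=> [|S S' bS bS'|S S' SS' bS]; rewrite /F0 /=.
  - by rewrite setDT; exact: metric_bounded0.
  - rewrite setDIr; exact: metric_boundedU.
  - by apply: metric_boundedS bS; exact: setDS.
have [F [FU F0F]] := ultraFilterLemma PF0.
have FD : F D by apply: F0F; rewrite /F0 /= setDv; exact: metric_bounded0.
have FB B : metric_bounded B -> F (~` B).
  move=> bB; apply: F0F; apply: metric_boundedS bB.
  by rewrite setDE setCK => y [].
have [y0 Dy0] := filter_ex FD.
(* Outside D the selection takes an arbitrary value, supplied by some A i, which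
   is nonempty because D is. *)
have /choice[a aP] (iy : 'I_k * Y) : exists x, D iy.2 ->
    A iy.1 x /\ mdist iy.2 (f x) <= r + 1.
  case: iy => i y /=; have [Dy|nDy] := pselect (D y).
    by have [_ [x Ax <-] yx] := thickening_near (Dy i I); exists x.
  by have [_ [x _ _] _] := thickening_near (Dy0 i I); exists x.
have r1 : 0 < r + 1 by rewrite addr_gt0.
have Faf i : F [set y | mdist (f (a (i, y))) y <= r + 1].
  by apply: filterS FD => y /(aP (i, y))[_]; rewrite /= metric_sym.
have FfB i B : metric_bounded B -> F (~` ((fun y => f (a (i, y))) @^-1` B)).
  move=> /(metric_bounded_thickening (r + 1))/FB FBr.
  apply: filterS (filterI FBr (Faf i)) => y [nBy ay] By; apply: nBy.
  by apply: (mem_thickening (a := f (a (i, y)))) => //; rewrite metric_sym.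
have FaB i B : metric_bounded B -> ~ F ((fun y => a (i, y)) @^-1` B).
  move=> /(coarse_image_bounded cf)/(FfB i) FnB FaB.
  have [y [nBy By]] := filter_ex (filterI FnB FaB).
  by apply: nBy; exists (a (i, y)).
have /choice[p pF] i := higson_ultra_cvg (fun y => a (i, y)) FU.
have [q qF] := higson_ultra_cvg (@id Y) FU.
have p_far i := ultra_limit_far dX FU (FaB i) (pF i).
have q_far : ~ range (@higson_embed R Y) q.
  apply: (ultra_limit_far dY FU _ qF) => B /FB FnB FB'.
  by have [y []] := filter_ex (filterI FnB FB').
have fpq i : higson_map dX cf (p i) = q.
  apply: (higson_limit_close _ r1 (Faf i) (FfB i) FB _ qF).
  have -> : @higson_embed R Y \o (fun y => f (a (i, y))) =
      higson_map dX cf \o (@higson_embed R X \o (fun y => a (i, y))).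
    by apply/funext => y /=; rewrite higson_map_embed.
  by apply: cvg_comp (pF i) _; exact: higson_map_continuous.
have clA i : closure (@higson_embed R X @` A i) (p i).
  move=> U pU.
  have FUa : F [set y | U (higson_embed (a (i, y)))] by exact: pF.
  have [y [Dy Uy]] := filter_ex (filterI FD FUa).
  exists (higson_embed (a (i, y))); split => //.
  by exists (a (i, y)) => //; have [] := aP (i, y) Dy.
pose P i : corona X := exist _ (p i) (mem_set (p_far i)).
pose Q : corona Y := exist _ q (mem_set q_far).
apply: (card_le_II_inj (fn Q) (p := P)) => [i j /(congr1 val) /= pij|i]; last first.
  by apply: val_inj; exact: fpq.
apply/eqP; apply: contrapT => /negP ij.
have /pair_divergesP := dA i j ij.
apply: (corona_closures_not_diverge pX dX (p_far i)) => l.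
by case: ifP => _; [|rewrite pij]; exact: clA.
Qed.

End CoronaMap.

(** * The equivalence *)

Theorem theorem5p1 (R : realType) (X Y : metricType R)
    (pX : proper_space X) (dX : topologically_discrete X)
    (pY : proper_space Y) (dY : topologically_discrete Y)
    (n : nat) (n_gt0 : (0 < n)%N) (f : X -> Y) (cf : coarse f) :
  [<-> coarsely_n_to_1 n f;
       n_to_1 n (corona_map pX dX dY cf);
       forall (k : nat) (A : 'I_k -> set X),
         gradually_disjoint A -> ~ diverges (fun i => f @` A i) -> (k <= n)%N].
Proof.
tfae.
- move=> fn; apply: gradually_disjoint_corona_n_to_1 => // k A.
  exact: coarsely_n_to_1_gradually_disjoint.
- by move=> fn k A; exact: corona_n_to_1_gradually_disjoint.
- exact: gradually_disjoint_coarsely_n_to_1.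
Qed.
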